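(* Let $F_q$ be the finite field with $q$ elements, $V=F_q^n$, and $1<k<n-1$. Let $U$ be a projective code $[n,k+1]_q$ with generator matrix $M$ whose rows $v_1,\dots,v_{k+1}$ form a basis of $U$ and whose columns are $l_1,\dots,l_n\in F_q^{k+1}$. Let $W$ be the set of all non-zero vectors $w\in F_q^{k+1}$ not proportional to any column of $M$, for $w=(w_1,\dots,w_{k+1})\in W$ let $C(w)=\{\sum_{i=1}^{k+1}a_iv_i : a_i\in F_q,\ \sum_{i=1}^{k+1}a_iw_i=0\}$, and let $Y\subseteq W$ be the set of all $w\in W$ such that $w\neq\alpha l_i+\beta l_j$ for all $\alpha,\beta\in F_q\setminus\{0\}$ and all columns $l_i,l_j$ of $M$. Let $\langle U]^{\Pi}_k$ be the set of all projective codes $[n,k]_q$ contained in $U$, and let $\langle Y\rangle$ denote the subspace of $F_q^{k+1}$ spanned by $Y$. Then $\langle U]^{\Pi}_k$ is contained in a line of $\mathcal G_k(V)$ if and only if $\dim\langle Y\rangle\le 2$. Moreover, $\langle U]^{\Pi}_k$ is contained in (a) all lines of $\mathcal G_k(V)$ if and only if $\dim\langle Y\rangle=0$; (b) precisely $[k]_q[n-k]_q$ lines of $\mathcal G_k(V)$ if and only if $\dim\langle Y\rangle=1$; (c) precisely one line of $\mathcal G_k(V)$ if and only if $\dim\langle Y\rangle=2$, and in this case this line is $[\bigcap_{y\in Y}C(y),U]_k$.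
   Context: A linear code $[n,k]_q$ is a $k$-dimensional subspace of $V=F_q^n$; a generator matrix is a matrix whose rows form a basis of the code. A linear code is projective if its generator matrices contain no zero columns and no two proportional columns. $\mathcal G_k(V)$ denotes the set of all $k$-dimensional subspaces of $V$. For subspaces $S\subset U'$ of $V$ with $\dim S<k<\dim U'$, $[S,U']_k$ is the set of all $k$-dimensional subspaces $K$ with $S\subset K\subset U'$; when $\dim S=k-1$ and $\dim U'=k+1$, $[S,U']_k$ is called a line of $\mathcal G_k(V)$. $[m]_q=(q^m-1)/(q-1)$. *)

(* Defs.v *)
From HB Require Import structures.
From mathcomp Require Import all_boot all_order all_algebra.

Set Implicit Arguments.
Unset Strict Implicit.
Unset Printing Implicit Defensive.

Import GRing.Theory.
Local Open Scope ring_scope.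

(* Over a finite field a vector space has finitely many subspaces, so sets of
   subspaces (and sets of such sets) can be taken in {set _}. *)
Import VectorInternalTheory.
HB.instance Definition _ (F : finFieldType) (vT : vectType F) :=
  [Countable of {vspace vT} by <:].
HB.instance Definition _ (F : finFieldType) (vT : vectType F) :=
  [Finite of {vspace vT} by <:].

Definition qnum (q m : nat) : nat := ((q ^ m - 1) %/ (q - 1))%N.

Section Codes.
Variables (F : finFieldType) (n : nat).
Implicit Types (U S K : {vspace 'rV[F]_n}).

Definition generator_matrix m (M : 'M[F]_(m, n)) U : bool :=
  basis_of U [seq row i M | i <- enum 'I_m].

Definition proportional m (u v : 'cV[F]_m) : bool :=
  [exists c : F, (c != 0) && (u == c *: v)].

Definition projective_code k U : bool :=
  (\dim U == k) &&
  [forall M : 'M[F]_(k, n), generator_matrix M U ==>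
    [forall i, col i M != 0] &&
    [forall i, forall j, (i != j) ==> ~~ proportional (col i M) (col j M)]].

Definition subspace_interval k S U : {set {vspace 'rV[F]_n}} :=
  [set K | [&& (S <= K)%VS, (K <= U)%VS & \dim K == k]].

Definition lines k : {set {set {vspace 'rV[F]_n}}} :=
  [set L | [exists S : {vspace 'rV[F]_n}, exists U : {vspace 'rV[F]_n},
     [&& (S <= U)%VS, \dim S == (k - 1)%N, \dim U == (k + 1)%N
       & L == subspace_interval k S U]]].

Definition projective_subcodes k U : {set {vspace 'rV[F]_n}} :=
  [set K | projective_code k K && (K <= U)%VS].

Section Generator.
Variables (m : nat) (M : 'M[F]_(m, n)).

Definition Wset : {set 'cV[F]_m} :=
  [set w | (w != 0) && [forall i, ~~ proportional w (col i M)]].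

Definition Yset : {set 'cV[F]_m} :=
  [set w in Wset |
    [forall i, forall j, forall a : F, forall b : F,
      (a != 0) && (b != 0) ==> (w != a *: col i M + b *: col j M)]].

(* The spanning set is itself closed under linear combinations: see CcodeP. *)
Definition Ccode (w : 'cV[F]_m) : {vspace 'rV[F]_n} :=
  <<enum [set (\sum_i a 0 i *: row i M)%R
         | a : 'rV[F]_m & (\sum_i a 0 i * w i 0 == 0)%R]>>%VS.

Lemma CcodeP (w : 'cV[F]_m) (v : 'rV[F]_n) :
  reflect (exists2 a : 'rV[F]_m, \sum_i a 0 i * w i 0 = 0
                               & v = \sum_i a 0 i *: row i M)
          (v \in Ccode w).
Proof.
pose f : 'Hom('rV[F]_m, 'rV[F]_n) := linfun (mulmxr M).
pose g : 'Hom('rV[F]_m, 'rV[F]_1) := linfun (mulmxr w).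
have fE a : f a = \sum_i a 0 i *: row i M by rewrite lfunE /= mulmx_sum_row.
have gE a : (g a == 0) = (\sum_i a 0 i * w i 0 == 0).
  rewrite lfunE /=; apply/eqP/eqP => [/matrixP/(_ 0 0)|H]; first by rewrite !mxE.
  by apply/matrixP => i j; rewrite !ord1 !mxE.
apply: (iffP idP) => [vC | [a ha ->]]; last first.
  by apply: memv_span; rewrite mem_enum; apply/imsetP; exists a; rewrite // inE ha.
suff /subvP/(_ v vC)/memv_imgP[a ka ->] : (Ccode w <= f @: lker g)%VS.
  by exists a; rewrite ?fE //; apply/eqP; rewrite -gE -memv_ker.
apply/span_subvP => u; rewrite mem_enum => /imsetP[a]; rewrite inE => ha ->.
by rewrite -fE memv_img // memv_ker gE.
Qed.

End Generator.
End Codes.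

(* Main.v *)
Require Import Defs.
From mathcomp Require Import all_boot all_order all_algebra.
From mathcomp Require Import finfield zify.

Set Implicit Arguments.
Unset Strict Implicit.
Unset Printing Implicit Defensive.

Import GRing.Theory.
Local Open Scope ring_scope.

(** The k-dimensional subspaces of U are the hyperplanes C(w) with w <> 0, where
    C(w) = C(w') exactly when w and w' are proportional, and C(w) is projective
    exactly when w lies in Y. A line of the Grassmannian is determined by any two
    of its points K1 <> K2 as [K1 :&: K2, K1 + K2]_k, and C(y1) :&: C(y2) is
    contained in C(y) exactly when y lies in <y1, y2>. Hence the lines containing
    the projective subcodes are all lines, the lines through one point, one line
    or none according to whether dim <Y> is 0, 1, 2 or more. Since the number
    [k]_q [n-k]_q of lines through a point lies strictly between 1 and the number
    of all lines, these four cases are told apart by counting. *)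

(** * Dimensions and existence of subspaces *)

Section VectorSpaces.
Variables (F : fieldType) (vT : vectType F).
Implicit Types (u v : vT) (S K U : {vspace vT}).

Lemma dim_add_line v K : v \notin K -> \dim (K + <[v]>) = (\dim K).+1.
Proof.
move=> vK; rewrite dimv_disjoint_sum.
  have -> : \dim <[v]> = 1%N; last by rewrite addn1.
  by rewrite dim_vline; case: eqP vK => // ->; rewrite mem0v.
apply/eqP; rewrite -subv0; apply/subvP => u /memv_capP[uK /vlineP[c u_cv]].
rewrite memv0; apply: contraNT vK => u0.
have c0 : c != 0 by apply: contraNneq u0 => c0; rewrite u_cv c0 scale0r.
by rewrite -[v](scalerK c0) -u_cv memvZ.
Qed.

Lemma dim_lt_memPn S U : (\dim S < \dim U)%N -> exists2 v, v \in U & v \notin S.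
Proof.
by move=> ltSU; apply/subvPn; apply: contraTN ltSU => /dimvS; rewrite -leqNgt.
Qed.

Lemma exists_extension S d :
  (\dim S <= d <= \dim {:vT})%N -> exists2 U, (S <= U)%VS & \dim U = d.
Proof.
elim: d => [|d IHd] /andP[leSd led].
  by exists S; [exact: subvv | apply/eqP; rewrite -leqn0].
move: leSd; rewrite leq_eqVlt => /orP[/eqP <-|leSd].
  by exists S; rewrite ?subvv.
have [|U SU dimU] := IHd; first by rewrite -ltnS leSd ltnW.
have [|v _ vU] := @dim_lt_memPn U {:vT}; first by rewrite dimU.
exists (U + <[v]>)%VS; last by rewrite dim_add_line ?dimU.
exact: subv_trans SU (addvSl _ _).
Qed.

Lemma exists_subspace U d : (d <= \dim U)%N -> exists2 S, (S <= U)%VS & \dim S = d.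
Proof.
elim: d => [|d IHd] led; first by exists 0%VS; rewrite ?sub0v ?dimv0.
have [S SU dimS] := IHd (ltnW led).
have [|v vU vS] := @dim_lt_memPn S U; first by rewrite dimS.
exists (S + <[v]>)%VS; last by rewrite dim_add_line ?dimS.
by rewrite subv_add SU -memvE.
Qed.

Lemma eq_subv_dim S U : (S <= U)%VS -> (\dim U <= \dim S)%N -> S = U.
Proof. by move=> SU leUS; apply/eqP; rewrite eqEdim SU. Qed.

(** If the sum had dimension at most [d], both summands would be equal to it. *)
Lemma dim_add_distinct K1 K2 d :
  \dim K1 = d -> \dim K2 = d -> K1 != K2 -> (d < \dim (K1 + K2))%N.
Proof.
move=> d1 d2; rewrite ltnNge; apply: contra => le12.
have {1}-> : K1 = (K1 + K2)%VS by apply: eq_subv_dim (addvSl _ _) _; rewrite d1.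
by rewrite eq_sym; apply/eqP/eq_subv_dim; rewrite ?addvSr ?d2.
Qed.

End VectorSpaces.

Lemma dim_rV (F : fieldType) m : \dim {:'rV[F]_m} = m.
Proof. by rewrite dimvf dim_matrix mul1r. Qed.

(** * Double annihilators of column vectors *)

Section Annihilators.
Variable F : fieldType.

(** The rows of [(cokermx A^T)^T] kill [A], hence also [B], which by [submxE] puts the column space
    of [B] inside that of [A]. The transposes appear because matrix inclusion compares row
    spaces. *)
Lemma annihilator_sub m p r (A : 'M[F]_(m, p)) (B : 'M_(m, r)) :
  (forall a : 'rV_m, a *m A = 0 -> a *m B = 0) -> exists D, B = A *m D.
Proof.
move=> annAB; suff /submxP[D eqB]: (B^T <= A^T)%MS.
  by exists D^T; rewrite -[B]trmxK eqB trmx_mul trmxK.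
have NA : (cokermx A^T)^T *m A = 0.
  by apply: trmx_inj; rewrite trmx_mul trmxK mulmx_coker trmx0.
have NB : (cokermx A^T)^T *m B = 0.
  apply/row_matrixP => i; rewrite row_mul row0; apply: annAB.
  by rewrite -row_mul NA row0.
by rewrite submxE -[B^T *m _]trmxK trmx_mul trmxK NB trmx0.
Qed.

Lemma annihilator_line m (w x : 'cV[F]_m) :
  (forall a : 'rV_m, a *m w = 0 -> a *m x = 0) -> exists c, x = c *: w.
Proof.
case/annihilator_sub => D ->; exists (D 0 0).
by rewrite {1}[D]mx11_scalar mul_mx_scalar.
Qed.

Lemma annihilator_plane m (w1 w2 x : 'cV[F]_m) :
  (forall a : 'rV_m, a *m w1 = 0 -> a *m w2 = 0 -> a *m x = 0) ->
  x \in (<[w1]> + <[w2]>)%VS.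
Proof.
(* The two blocks of [D] are the coefficients of [x] along [w1] and [w2]. *)
move=> ann; have [|D ->] := @annihilator_sub m (1 + 1) 1 (row_mx w1 w2) x.
  move=> a; rewrite mul_mx_row => /eqP; rewrite row_mx_eq0 => /andP[/eqP a1 /eqP a2].
  exact: ann.
rewrite -[D]vsubmxK mul_row_col memv_add //.
  by rewrite [usubmx D]mx11_scalar mul_mx_scalar memvZ ?memv_line.
by rewrite [dsubmx D]mx11_scalar mul_mx_scalar memvZ ?memv_line.
Qed.

End Annihilators.

(** * Generator matrices and the hyperplanes C(w) *)

Section Generators.
Variables (F : finFieldType) (n : nat).
Implicit Types (K S U : {vspace 'rV[F]_n}).

Lemma exists_generator K m : \dim K = m -> exists M : 'M_(m, n), generator_matrix M K.
Proof.
move=> <-; exists (\matrix_(i < \dim K) (vbasis K)`_i); rewrite /generator_matrix.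
suff -> : [seq row i (\matrix_(i0 < \dim K) (vbasis K)`_i0) | i <- enum 'I_(\dim K)]
          = vbasis K by exact: vbasisP.
rewrite -[RHS](mkseq_nth 0) size_tuple /mkseq -val_enum_ord -map_comp.
by apply: eq_map => i /=; rewrite rowK.
Qed.

Section Generator.
Variables (m : nat) (M : 'M[F]_(m, n)) (U : {vspace 'rV[F]_n}).
Hypothesis genM : generator_matrix M U.

Lemma dim_generator : \dim U = m.
Proof.
have := genM; rewrite /generator_matrix basisEdim => /andP[_].
have := dim_span [seq row i M | i <- enum 'I_m].
rewrite (span_basis genM) size_map size_enum_ord => le1 le2.
by apply/eqP; rewrite eqn_leq le1.
Qed.

Lemma mem_generator v : reflect (exists a, v = a *m M) (v \in U).
Proof.
rewrite -(span_basis genM); apply: (iffP idP) => [vU|[a ->]]; last first.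
  rewrite mulmx_sum_row; apply: memv_suml => i _; apply/memvZ/memv_span.
  by apply/mapP; exists i; rewrite ?mem_enum.
pose f : 'Hom('rV[F]_m, 'rV[F]_n) := linfun (mulmxr M).
suff /subvP/(_ v vU)/memv_imgP[a _ ->] : (<<[seq row i M | i <- enum 'I_m]>> <= limg f)%VS.
  by exists a; rewrite lfunE.
apply/span_subvP => _ /mapP[i _ ->]; rewrite rowE.
by have := memv_img f (memvf (delta_mx 0 i)); rewrite lfunE.
Qed.

(** Rank-nullity: the image [U] has the same dimension [m] as the source. Hence coordinates along
    the rows are unique. *)
Lemma generator_lker0 : lker (linfun (mulmxr M) : 'Hom('rV[F]_m, 'rV[F]_n)) = 0%VS.
Proof.
set f := linfun _; have := limg_ker_dim f {:'rV_m}; rewrite capfv.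
suff -> : limg f = U.
  rewrite dim_generator dim_rV => /eqP.
  by rewrite -[X in _ == X]add0n eqn_add2r dimv_eq0 => /eqP.
apply/vspaceP => v; apply/memv_imgP/mem_generator => [[a _ ->]|[a ->]]; exists a => //.
  by rewrite lfunE.
by rewrite memvf.
by rewrite lfunE.
Qed.

Lemma generator_inj (a b : 'rV_m) : a *m M = b *m M -> a = b.
Proof.
move/eqP: generator_lker0 => /lker0P inj_f eq_ab; apply: inj_f.
by rewrite !lfunE.
Qed.

Lemma mem_Ccode (w : 'cV_m) v :
  reflect (exists2 a : 'rV_m, a *m w = 0 & v = a *m M) (v \in Ccode M w).
Proof.
apply: (iffP (CcodeP M w v)) => -[a aw ->]; exists a.
- by apply/matrixP => i j; rewrite !ord1 !mxE.
- by rewrite mulmx_sum_row.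
- by move/matrixP/(_ 0 0): aw; rewrite !mxE.
- by rewrite mulmx_sum_row.
Qed.

Lemma mulmx_mem_Ccode (w : 'cV_m) (a : 'rV_m) :
  (a *m M \in Ccode M w) = (a *m w == 0).
Proof.
apply/mem_Ccode/eqP => [[b bw /generator_inj -> //]|aw]; by exists a.
Qed.

Lemma Ccode_sub w : (Ccode M w <= U)%VS.
Proof. by apply/subvP => _ /mem_Ccode[a _ ->]; apply/mem_generator; exists a. Qed.

(** The code is the injective image of the kernel of the linear form sending [a] to [a *m w], which
    is onto because [w] is non-zero. *)
Lemma dim_Ccode (w : 'cV_m) : w != 0 -> (\dim (Ccode M w)).+1 = m.
Proof.
move=> w0; pose f : 'Hom('rV[F]_m, 'rV[F]_n) := linfun (mulmxr M).
pose g : 'Hom('rV[F]_m, 'rV[F]_1) := linfun (mulmxr w).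
have -> : Ccode M w = (f @: lker g)%VS.
  apply/vspaceP => v; apply/mem_Ccode/memv_imgP => [[a aw ->]|[a]].
    by exists a; rewrite ?lfunE // memv_ker lfunE /= aw.
  by rewrite memv_ker lfunE => /eqP aw ->; exists a; rewrite ?lfunE.
rewrite limg_dim_eq ?generator_lker0 ?capv0 //.
have := limg_ker_dim g {:'rV_m}; rewrite capfv dim_rV => dim_g.
apply: etrans dim_g; rewrite -addn1; congr addn; apply/eqP; rewrite eq_sym eqn_leq.
have := dimvS (subvf (limg g)); rewrite dim_rV => -> /=.
rewrite lt0n dimv_eq0; apply: contraNneq w0 => g0.
apply/eqP/row_matrixP => i; rewrite row0 rowE.
have := memv_img g (memvf (delta_mx 0 i)).
by rewrite g0 memv0 lfunE => /eqP.
Qed.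

(** The coordinate rows of a basis of [S] form a matrix [A] with fewer rows than columns, so its
    cokernel has a non-zero column [w]. All rows of [A] kill [w], and equal dimensions turn the
    inclusion of [S] in C(w) into equality. *)
Lemma hyperplane_Ccode S :
  (S <= U)%VS -> (\dim S).+1 = m -> exists2 w, w != 0 & S = Ccode M w.
Proof.
move=> SU dimS.
pose f : 'Hom('rV[F]_m, 'rV[F]_n) := linfun (mulmxr M).
pose A := \matrix_(i < \dim S) (f^-1%VF (vbasis S)`_i).
have rowA (i : 'I_(\dim S)) : row i A *m M = (vbasis S)`_i.
  have -> : row i A *m M = f (row i A) by rewrite lfunE.
  rewrite rowK limg_lfunVK //.
  have /mem_generator[a ->] : (vbasis S)`_i \in U.
    by apply: (subvP SU); apply: vbasis_mem; rewrite mem_nth ?size_tuple.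
  by apply/memv_imgP; exists a; rewrite ?memvf ?lfunE.
have [j wj] : exists j, col j (cokermx A) != 0.
  apply/existsP; apply: contraT => /existsPn col0.
  have : \rank (cokermx A) == 0.
    rewrite mxrank_eq0; apply/eqP/trmx_inj/row_matrixP => j.
    by rewrite -tr_col; move/negbNE/eqP: (col0 j) ->; rewrite !trmx0 row0.
  by rewrite mxrank_coker subn_eq0 leqNgt -{2}dimS ltnS rank_leq_row.
exists (col j (cokermx A)) => //; apply: eq_subv_dim; last first.
  by rewrite -ltnS dimS dim_Ccode.
rewrite -[X in (X <= _)%VS](span_basis (vbasisP S)); apply/span_subvP => _ /tnthP[i ->].
rewrite (tnth_nth 0) -rowA; apply/mem_Ccode; exists (row i A) => //.
by rewrite colE mulmxA -row_mul mulmx_coker row0 mul0mx.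
Qed.

(** The intersection consists of the codewords whose coordinates kill both [w1] and [w2], so the
    inclusion is one of annihilators and [annihilator_plane] applies. *)
Lemma Ccode_capS (w1 w2 x : 'cV_m) :
  (Ccode M w1 :&: Ccode M w2 <= Ccode M x)%VS = (x \in <[w1]> + <[w2]>)%VS.
Proof.
apply/idP/idP => [capS|].
  apply: annihilator_plane => a a1 a2; apply/eqP; rewrite -mulmx_mem_Ccode.
  by apply: (subvP capS); rewrite memv_cap !mulmx_mem_Ccode a1 a2 eqxx.
case/memv_addP => _ /vlineP[c ->] [_ /vlineP[d ->] ->].
apply/subvP => v /memv_capP[/mem_Ccode[a a1 ->]].
rewrite !mulmx_mem_Ccode => /eqP a2.
by rewrite mulmxDr -!scalemxAr a1 a2 !scaler0 addr0.
Qed.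

(** The case [w1 = w2] of [Ccode_capS]: inclusion already means equality, as both codes have the
    same dimension. *)
Lemma Ccode_eq (w x : 'cV_m) : w != 0 -> x != 0 ->
  (Ccode M x == Ccode M w) = (x \in <[w]>%VS).
Proof.
move=> w0 x0; rewrite -[<[w]>%VS]addvv -Ccode_capS capvv eq_sym eqEdim.
by rewrite -ltnS !dim_Ccode ?leqnn ?andbT.
Qed.

End Generator.
End Generators.

(** * Projectivity expressed through codewords and through Y *)

Section Projectivity.
Variables (F : finFieldType) (n : nat).
Implicit Types (K S U : {vspace 'rV[F]_n}).

Lemma mulmx_col m (a : 'rV[F]_m) (M : 'M_(m, n)) i : a *m col i M = ((a *m M) 0 i)%:M.
Proof. by rewrite colE mulmxA -colE [LHS]mx11_scalar mxE. Qed.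

(** Column [i] lists the [i]-th coordinates of rows spanning [K], so the condition depends on [K]
    alone and not on its generator matrix. *)
Lemma generator_col_eq0 m (M : 'M_(m, n)) K i : generator_matrix M K ->
  col i M = 0 <-> {in K, forall v : 'rV_n, v 0 i = 0}.
Proof.
move=> genM; split=> [colM _ /(mem_generator genM)[a ->] | K0].
  by have := mulmx_col a M i; rewrite colM mulmx0 => /matrixP/(_ 0 0); rewrite !mxE eqxx.
apply/colP => r; rewrite !mxE -[RHS](K0 (row r M)) ?mxE //.
by apply/(mem_generator genM); exists (delta_mx 0 r); rewrite -rowE.
Qed.

Lemma generator_col_eqZ m (M : 'M_(m, n)) K i j c : generator_matrix M K ->
  col i M = c *: col j M <-> {in K, forall v : 'rV_n, v 0 i = c * v 0 j}.
Proof.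
move=> genM; split=> [colM _ /(mem_generator genM)[a ->] | Kc].
  have := mulmx_col a M i; rewrite colM -scalemxAr mulmx_col => /matrixP/(_ 0 0).
  by rewrite !mxE eqxx !mulr1n.
apply/colP => r; have := Kc (row r M); rewrite !mxE; apply.
by apply/(mem_generator genM); exists (delta_mx 0 r); rewrite -rowE.
Qed.

(** All generator matrices of [K] satisfy the same column conditions, and at least one such matrix
    exists, so projectivity becomes a condition on codewords. *)
Lemma projective_codeP m K :
  reflect [/\ \dim K = m, forall i, ~ {in K, forall v : 'rV_n, v 0 i = 0}
            & forall i j c, i != j -> c != 0 -> ~ {in K, forall v : 'rV_n, v 0 i = c * v 0 j}]
          (projective_code m K).
Proof.
apply: (iffP andP) => [[/eqP dimK /forallP gens] | [dimK nz np]].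
  have [M genM] := exists_generator dimK.
  have := gens M; rewrite genM => /andP[/forallP nz /forallP np]; split=> // [i|i j c ij c0].
    by move/(generator_col_eq0 i genM)/eqP; apply/negP.
  move/(generator_col_eqZ i j c genM)/eqP => eq_ij.
  have /forallP/(_ j) := np i; rewrite ij => /existsP[]; exists c; exact/andP.
split; first exact/eqP.
apply/forallP => M; apply/implyP => genM; apply/andP; split; apply/forallP => i.
  by apply/eqP => /(generator_col_eq0 i genM); apply: nz.
apply/forallP => j; apply/implyP => ij; apply/existsP => -[c /andP[c0 /eqP]].
by move/(generator_col_eqZ i j c genM); apply: np.
Qed.

Section Subcodes.
Variables (k : nat) (M : 'M[F]_(k.+1, n)) (U : {vspace 'rV[F]_n}).
Hypotheses (genM : generator_matrix M U) (projU : projective_code k.+1 U).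

Lemma projective_col_neq0 i : col i M != 0.
Proof.
case/projective_codeP: projU => _ nz _.
by apply/eqP => /(generator_col_eq0 i genM); apply: nz.
Qed.

Lemma projective_colP i j c : i != j -> c != 0 -> col i M != c *: col j M.
Proof.
case/projective_codeP: projU => _ _ np ij c0.
by apply/eqP => /(generator_col_eqZ i j c genM); apply: np.
Qed.

(* A coordinate, or a linear relation between two coordinates, vanishes on C(w)
   exactly when the corresponding combination of columns is a multiple of w. *)
Lemma projective_Ccode w : w != 0 -> projective_code k (Ccode M w) = (w \in Yset M).
Proof.
move=> w0; have dimC : \dim (Ccode M w) = k by apply/succn_inj; apply: dim_Ccode genM _ w0.
apply/projective_codeP/idP => [[_ nz np] | ].
  rewrite !inE w0 /=; apply/andP; split.
    apply/forallP => i; apply/existsP => -[c /andP[c0 /eqP eq_w]].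
    apply: (nz i) => _ /mem_Ccode[a aw ->]; move: aw.
    rewrite eq_w -scalemxAr mulmx_col => /matrixP/(_ 0 0).
    by rewrite !mxE eqxx => /eqP; rewrite mulf_eq0 (negPf c0) => /eqP.
  apply/'forall_'forall_forallP => i j a; apply/forallP => b; apply/implyP => /andP[a0 b0].
  apply/eqP => eq_w.
  have mem_C (v : 'rV_n) : v \in Ccode M w -> a * v 0 i + b * v 0 j = 0.
    case/mem_Ccode => x xw ->; move: xw.
    rewrite eq_w mulmxDr -!scalemxAr !mulmx_col => /matrixP/(_ 0 0).
    by rewrite !mxE eqxx.
  (* [Yset] also excludes combinations with [i = j]: here [w] is [a + b] times one column, and
     [a + b] is non-zero because [w] is. *)
  have [eq_ij|ij] := eqVneq i j.
    move: w0; rewrite eq_w eq_ij -scalerDl scaler_eq0 negb_or => /andP[ab0 _].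
    apply: (nz j) => v /mem_C; rewrite eq_ij -mulrDl => /eqP.
    by rewrite mulf_eq0 (negPf ab0) => /eqP.
  apply: (np i j (- (b / a)) ij) => [|v /mem_C /eqP].
    by rewrite oppr_eq0 mulf_neq0 ?invr_eq0.
  rewrite addr_eq0 => /eqP eq_ab; apply: (mulfI a0).
  by rewrite eq_ab mulrA mulrN mulrCA divff // mulr1 mulNr.
rewrite !inE => /andP[/andP[_ /forallP notcol] /forallP notpair]; split=> // [i|i j c ij c0] Ci.
  have [a aw|c col_i] := @annihilator_line _ _ w (col i M).
    by rewrite mulmx_col Ci ?raddf0 // (mulmx_mem_Ccode genM) aw.
  have c0 : c != 0.
    by apply: contraNneq (projective_col_neq0 i) => c0; rewrite col_i c0 scale0r.
  have /existsP[] := notcol i; exists c^-1.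
  by rewrite invr_eq0 c0 col_i scalerK //=.
have [a aw|d eq_d] := @annihilator_line _ _ w (col i M - c *: col j M).
  rewrite mulmxBr -scalemxAr !mulmx_col Ci ?(mulmx_mem_Ccode genM) ?aw //.
  by rewrite scale_scalar_mx subrr.
have d0 : d != 0.
  apply: contraTneq (projective_colP ij c0) => d0.
  by rewrite negbK -subr_eq0 eq_d d0 scale0r.
(* Solving [col i M - c *: col j M = d *: w] for [w] gives these coefficients, a combination that
   [Yset] excludes. *)
have /forallP/(_ j)/forallP/(_ d^-1)/forallP/(_ (- (d^-1 * c)))/implyP := notpair i.
rewrite invr_eq0 d0 oppr_eq0 mulf_neq0 ?invr_eq0 // => /(_ isT)/eqP; apply.
by rewrite -[w](scalerK d0) -eq_d scalerBr scalerA scaleNr.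
Qed.

Lemma Yset_neq0 y : y \in Yset M -> y != 0.
Proof. by rewrite !inE => /andP[/andP[]]. Qed.

(** Every subcode of dimension [k] is some C(w) by [hyperplane_Ccode], and projectivity then selects
    the [w] in [Y]. *)
Lemma projective_subcodesE : projective_subcodes k U = Ccode M @: Yset M.
Proof.
apply/setP => K; rewrite inE; apply/andP/imsetP => [[projK KU] | [y yY ->]].
  have [|w w0 eqK] := hyperplane_Ccode genM KU.
    by case/projective_codeP: projK => ->.
  by exists w; rewrite // -projective_Ccode // -eqK.
by rewrite projective_Ccode ?Yset_neq0 // (Ccode_sub genM).
Qed.

End Subcodes.
End Projectivity.

(** * Counting the subspaces just below and just above a given one *)

Section Counting.
Variables (F : finFieldType) (n : nat).
Implicit Types (K S U : {vspace 'rV[F]_n}).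

(** Double counting; both counts below list subspaces by vectors, each subspace arising equally
    often. *)
Lemma card_uniform_fibres (T T' : finType) (f : T -> T') (D : {set T}) c :
  (forall x, x \in D -> #|[set z in D | f z == f x]| = c) -> #|D| = (#|f @: D| * c)%N.
Proof.
move=> fib; rewrite -sum1_card (partition_big_imset f) /= -sum_nat_const.
apply: eq_bigr => _ /imsetP[x xD ->]; rewrite -(fib x xD) -sum1_card.
by apply: eq_bigl => z; rewrite inE.
Qed.

(** The division in [qnum] is exact. Counts are compared after multiplication by q - 1, which avoids
    truncated quotients. *)
Lemma qnumE (q m : nat) : (1 < q)%N -> (qnum q m * (q - 1) = q ^ m - 1)%N.
Proof. by move=> q1; rewrite /qnum divnK // !subn1 predn_exp dvdn_mulr. Qed.

Lemma qnum_gt1 (q m : nat) : (1 < q)%N -> (1 < m)%N -> (1 < qnum q m)%N.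
Proof.
move=> q1 m1; rewrite -(@ltn_pmul2r (q - 1)) ?subn_gt0 // qnumE // mul1n.
have q_lt : (q < q ^ m)%N by rewrite -[X in (X < _)%N]expn1 ltn_exp2l.
exact: ltn_sub2r (ltn_trans q1 q_lt) q_lt.
Qed.

(** Each hyperplane is C(w) for exactly q - 1 of the q^(k+1) - 1 non-zero vectors [w], namely the
    non-zero multiples of one of them. *)
Lemma card_hyperplanes K k :
  \dim K = k.+1 -> #|[set S : {vspace 'rV[F]_n} | (S <= K)%VS & \dim S == k]| = qnum #|F| k.+1.
Proof.
move=> dimK; have [M genM] := exists_generator dimK.
have q1 := card_finNzRing_gt1 F; apply/eqP.
rewrite -(@eqn_pmul2r (#|F| - 1)) ?subn_gt0 // qnumE //.
have -> : [set S : {vspace 'rV[F]_n} | (S <= K)%VS & \dim S == k] = Ccode M @: [set~ 0].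
  apply/setP => S; rewrite inE; apply/andP/imsetP => [[SK /eqP dimS] | [w]].
    have [|w w0 ->] := hyperplane_Ccode genM SK; first by rewrite dimS.
    by exists w; rewrite // !inE.
  rewrite !inE => w0 ->; rewrite (Ccode_sub genM) -eqSS; split=> //.
  by rewrite (dim_Ccode genM).
rewrite -(@card_uniform_fibres _ _ (Ccode M) [set~ 0] (#|F| - 1)).
  by rewrite cardsC1 card_mx muln1 subn1.
move=> w; rewrite !inE => w0.
rewrite -[RHS](_ : #|[set c *: w | c in [set~ (0 : F)]]| = _); last first.
  rewrite card_imset ?cardsC1 ?subn1 // => c d /eqP.
  by rewrite -subr_eq0 -scalerBl scaler_eq0 (negPf w0) orbF subr_eq0 => /eqP.
apply: eq_card => x; rewrite !inE; apply/andP/imsetP => [[x0] | [c]].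
  rewrite (Ccode_eq genM) // => /vlineP[c eq_x]; exists c => //.
  by rewrite !inE; apply: contraNneq x0 => c0; rewrite eq_x c0 scale0r.
rewrite !inE => c0 ->; have x0 : c *: w != 0 by rewrite scaler_eq0 negb_or c0.
by rewrite (Ccode_eq genM) // memvZ ?memv_line.
Qed.

(** Each cover [U] is [K + <[v]>] for exactly the q^(k+1) - q^k vectors [v] of [U] outside [K]. *)
Lemma card_covers K k :
  \dim K = k -> (k <= n)%N ->
  #|[set U : {vspace 'rV[F]_n} | (K <= U)%VS & \dim U == k.+1]| = qnum #|F| (n - k).
Proof.
move=> dimK kn; have q1 := card_finNzRing_gt1 F; apply/eqP.
have qk0 : (0 < #|F| ^ k)%N by rewrite expn_gt0 ltnW.
(* Scaling by q^k as well makes the right-hand side q^n - q^k, the number of vectors outside [K]. *)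
rewrite -(@eqn_pmul2r (#|F| - 1)) ?subn_gt0 // qnumE // -(eqn_pmul2l qk0).
rewrite mulnCA [(_ ^ k * (_ - 1))%N]mulnBr muln1 -expnSr.
rewrite [X in _ == X]mulnBr muln1 -expnD subnKC //.
pose f v := (K + <[v]>)%VS.
have dimf v : v \notin K -> \dim (f v) = k.+1 by move=> vK; rewrite dim_add_line ?dimK.
have -> : [set U : {vspace 'rV[F]_n} | (K <= U)%VS & \dim U == k.+1]
          = f @: [set v | v \notin K].
  apply/setP => U; rewrite inE; apply/andP/imsetP => [[KU /eqP dimU] | [v]].
    have [|v vU vK] := @dim_lt_memPn _ _ K U; first by rewrite dimU dimK.
    exists v; rewrite ?inE //; apply/esym/eq_subv_dim; last by rewrite dimU dimf.
    by rewrite subv_add KU -memvE.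
  by rewrite inE => vK ->; rewrite addvSl dimf.
have cardD U : (K <= U)%VS -> #|[set v in U | v \notin K]| = (#|F| ^ \dim U - #|F| ^ k)%N.
  move=> KU; rewrite -dimK -!card_vspace -(cardsE (mem U)) -(cardsE (mem K)).
  rewrite -cardsDS; last by apply/subsetP => v; rewrite !inE; apply: (subvP KU).
  by apply: eq_card => v; rewrite !inE andbC.
rewrite -(@card_uniform_fibres _ _ f [set v | v \notin K] (#|F| ^ k.+1 - #|F| ^ k)).
  have := cardD fullv (subvf K); rewrite dim_rV => <-.
  by apply/eqP/eq_card => v; rewrite !inE memvf.
move=> v; rewrite inE => vK; rewrite -(dimf v vK) -cardD ?addvSl //.
apply: eq_card => u; rewrite !inE; apply/andP/andP => [[uK /eqP <-] | [uf uK]].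
  by rewrite memvE addvSr.
split=> //; apply/eqP/eq_subv_dim; last by rewrite !dimf.
by rewrite subv_add addvSl -memvE.
Qed.
End Counting.

(** * Lines of the Grassmannian *)

Section Lines.
Variables (F : finFieldType) (n k : nat).
Hypothesis k_gt0 : (0 < k)%N.
Implicit Types (K S U : {vspace 'rV[F]_n}).

Lemma linesP L :
  reflect (exists S U, [/\ (S <= U)%VS, \dim S = k.-1, \dim U = k.+1
                         & L = subspace_interval k S U])
          (L \in lines F n k).
Proof.
rewrite inE; apply: (iffP existsP) => [[S /existsP[U]] | [S [U [SU dS dU ->]]]].
  rewrite subn1 addn1 => /and4P[SU /eqP dS /eqP dU /eqP ->]; by exists S, U.
by exists S; apply/existsP; exists U; rewrite subn1 addn1 SU dS dU !eqxx.
Qed.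

(** Supplies the two points from which [line_determined] recovers the ends of a line. *)
Lemma line_two_points S U : (S <= U)%VS -> \dim S = k.-1 -> \dim U = k.+1 ->
  exists K1 K2, [/\ K1 \in subspace_interval k S U,
                    K2 \in subspace_interval k S U & K1 != K2].
Proof.
move=> SU dS dU.
have pt v : v \in U -> v \notin S -> (S + <[v]>)%VS \in subspace_interval k S U.
  by move=> vU vS; rewrite inE addvSl subv_add SU -memvE vU dim_add_line // dS prednK /=.
have [|v1 v1U v1S] := @dim_lt_memPn _ _ S U; first by rewrite dS dU prednK.
have [|v2 v2U v2K] := @dim_lt_memPn _ _ (S + <[v1]>)%VS U.
  by rewrite dim_add_line // dS dU prednK.
have v2S : v2 \notin S by apply: contra v2K; apply: (subvP (addvSl _ _)).
exists (S + <[v1]>)%VS, (S + <[v2]>)%VS; split; rewrite ?pt //.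
by apply: contraNneq v2K => ->; rewrite memvE addvSr.
Qed.

(** The sum has dimension above [k] and lies in [U], so it is [U]; the intersection then has
    dimension 2k - (k+1) = k - 1, that of [S]. *)
Lemma line_determined S U K1 K2 : \dim S = k.-1 -> \dim U = k.+1 ->
  K1 \in subspace_interval k S U -> K2 \in subspace_interval k S U -> K1 != K2 ->
  S = (K1 :&: K2)%VS /\ U = (K1 + K2)%VS.
Proof.
move=> dS dU; rewrite !inE => /and3P[SK1 K1U /eqP d1] /and3P[SK2 K2U /eqP d2] K12.
have lt_add := dim_add_distinct d1 d2 K12.
have addU : (K1 + K2 <= U)%VS by rewrite subv_add K1U.
split; last by apply/esym/eq_subv_dim; rewrite ?dU.
apply: eq_subv_dim; first by rewrite subv_cap SK1.
have := dimv_sum_cap K1 K2; rewrite d1 d2 dS; lia.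
Qed.

(** A line through [K] is a choice of a hyperplane [S] of [K] and a cover [U] of [K]. Distinct
    choices give distinct lines, since two points of a line determine both ends. *)
Lemma card_lines_through K : \dim K = k -> (k <= n)%N ->
  #|[set L in lines F n k | K \in L]| = (qnum #|F| k * qnum #|F| (n - k))%N.
Proof.
move=> dK kn; rewrite -(card_covers dK kn).
have dK' : \dim K = k.-1.+1 by rewrite prednK.
have := card_hyperplanes dK'; rewrite prednK // => <-; rewrite -cardsX.
pose f (p : {vspace 'rV[F]_n} * {vspace 'rV[F]_n}) := subspace_interval k p.1 p.2.
rewrite -(@card_in_imset _ _ f).
  apply: eq_card => L; rewrite inE; apply/andP/imsetP => [[/linesP[S [U [SU dS dU ->]]]]|].
    by rewrite inE => /and3P[SK KU _]; exists (S, U); rewrite ?inE //= SK KU dS dU !eqxx.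
  case=> -[S U] SU ->; rewrite !inE /= in SU.
  have /andP[/andP[SK /eqP dS] /andP[KU /eqP dU]] := SU.
  split; last by rewrite inE SK KU dK eqxx.
  by apply/linesP; exists S, U; rewrite (subv_trans SK KU).
move=> [S U] [S' U']; rewrite !inE /=.
move=> /andP[/andP[SK /eqP dS] /andP[KU /eqP dU]] /andP[/andP[_ /eqP dS'] /andP[_ /eqP dU']].
rewrite /f /= => eqL.
have [K1 [K2 [K1L K2L K12]]] := line_two_points (subv_trans SK KU) dS dU.
have [-> ->] := line_determined dS dU K1L K2L K12.
by rewrite eqL in K1L K2L; have [-> ->] := line_determined dS' dU' K1L K2L K12.
Qed.

(** It suffices that the lower end of the line contains a vector [v] outside [K]. The rest of that
    end is a subspace [T] of dimension k - 2, which calls for 1 < k. *)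
Lemma exists_line_avoiding K : (1 < k < n)%N -> \dim K = k ->
  exists2 L, L \in lines F n k & K \notin L.
Proof.
move=> /andP[k1 kn] dK.
have [|v _ vK] := @dim_lt_memPn _ _ K {:'rV[F]_n}; first by rewrite dK dim_rV.
have [|T TK dT] := @exists_subspace _ _ K k.-2; first by rewrite dK; lia.
have vT : v \notin T by apply: contra vK; apply: (subvP TK).
have dS : \dim (T + <[v]>) = k.-1 by rewrite dim_add_line // dT; lia.
have [|U SU dU] := @exists_extension _ _ (T + <[v]>)%VS k.+1.
  by rewrite dS dim_rV; lia.
exists (subspace_interval k (T + <[v]>)%VS U).
  by apply/linesP; exists (T + <[v]>)%VS, U.
rewrite inE; apply: contra vK => /and3P[SK _ _].
by apply: (subvP SK); rewrite memvE addvSr.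
Qed.

End Lines.

(** * Lines containing all projective subcodes, by the dimension of the span of Y *)

Section ProjectiveSubcodes.
Variables (F : finFieldType) (n k : nat).
Hypothesis k_gt1 : (1 < k)%N.
Variables (U : {vspace 'rV[F]_n}) (M : 'M[F]_(k.+1, n)).
Hypotheses (projU : projective_code k.+1 U) (genM : generator_matrix M U).

Let k_gt0 : (0 < k)%N := ltnW k_gt1.
Let Y := Yset M.
Let P := projective_subcodes k U.
Let PE : P = Ccode M @: Y := projective_subcodesE genM projU.

Definition lines_over : {set {set {vspace 'rV[F]_n}}} :=
  [set L in lines F n k | P \subset L].

Lemma dim_CcodeY y : y \in Y -> \dim (Ccode M y) = k.
Proof. by move=> yY; apply: succn_inj; rewrite (dim_Ccode genM) ?(Yset_neq0 yY). Qed.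

Lemma Yset_span y : y \in Y -> y \in <<enum Y>>%VS.
Proof. by move=> yY; rewrite memv_span ?mem_enum. Qed.

Lemma span_Yset_sub (T : {vspace 'cV[F]_k.+1}) :
  (forall y, y \in Y -> y \in T) -> (<<enum Y>> <= T)%VS.
Proof. by move=> YT; apply/span_subvP => y; rewrite mem_enum; apply: YT. Qed.

(** [Y] omits the zero vector, so a zero span makes [Y], and with it [P], empty. *)
Lemma lines_over_dim0 : \dim <<enum Y>> = 0%N -> lines_over = lines F n k.
Proof.
move/eqP; rewrite dimv_eq0 => /eqP Y0; apply/setP => L; rewrite inE PE.
have -> : Y = set0.
  apply/setP => y; rewrite in_set0; apply/negP => yY.
  by have := Yset_span yY; rewrite Y0 memv0 (negPf (Yset_neq0 yY)).
by rewrite imset0 sub0set andbT.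
Qed.

(** All members of [Y] are proportional, so [P] is a single point. *)
Lemma lines_over_dim1 : \dim <<enum Y>> = 1%N ->
  exists2 K, \dim K = k & lines_over = [set L in lines F n k | K \in L].
Proof.
move=> dY.
have [y yY] : exists y, y \in Y.
  apply/set0Pn; apply: contra_eq_neq dY => ->; by rewrite enum_set0 span_nil dimv0.
exists (Ccode M y); first exact: dim_CcodeY.
have y0 := Yset_neq0 yY.
apply/setP => L; rewrite !inE PE; congr andb; apply/subsetP/idP => [|yL _ /imsetP[x xY ->]].
  by apply; apply: imset_f.
suff /eqP-> : Ccode M x == Ccode M y by [].
rewrite (Ccode_eq genM) ?(Yset_neq0 xY) //.
suff -> : <[y]>%VS = <<enum Y>>%VS by apply: Yset_span.
by apply: eq_subv_dim; rewrite ?dY ?dim_vline ?y0 // -memvE Yset_span.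
Qed.

Lemma Yset_independent_pair : (1 < \dim <<enum Y>>)%N ->
  exists y1 y2, [/\ y1 \in Y, y2 \in Y, y2 \notin <[y1]>%VS & Ccode M y1 != Ccode M y2].
Proof.
move=> dY.
have [y1 y1Y] : exists y, y \in Y.
  by apply/set0Pn; apply: contraTneq dY => ->; rewrite enum_set0 span_nil dimv0.
have /existsP[y2 /andP[y2Y y12]] : [exists y, (y \in Y) && (y \notin <[y1]>%VS)].
  apply: contraLR dY => /existsPn Yy1; rewrite -leqNgt.
  have /dimvS : (<<enum Y>> <= <[y1]>)%VS.
    by apply: span_Yset_sub => y yY; have := Yy1 y; rewrite yY negbK.
  by rewrite dim_vline (Yset_neq0 y1Y).
exists y1, y2; split=> //.
by rewrite eq_sym (Ccode_eq genM) ?(Yset_neq0 y1Y) ?(Yset_neq0 y2Y).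
Qed.

(** The two points fix the line, and every further C(y) on it contains their intersection, which
    puts [y] in the plane of [y1] and [y2]. This gives uniqueness in dimension 2 and impossibility
    above it. *)
Lemma lines_over_pair y1 y2 L : y1 \in Y -> y2 \in Y -> Ccode M y1 != Ccode M y2 ->
  L \in lines_over ->
  L = subspace_interval k (Ccode M y1 :&: Ccode M y2) U
  /\ (<<enum Y>> <= <[y1]> + <[y2]>)%VS.
Proof.
move=> y1Y y2Y C12; rewrite inE => /andP[/linesP[S [U' [SU dS dU ->]]]].
rewrite PE => /subsetP PL; have memL y (yY : y \in Y) := PL _ (imset_f (Ccode M) yY).
have [eqS eqU] := line_determined k_gt0 dS dU (memL _ y1Y) (memL _ y2Y) C12.
split.
  rewrite -eqS; suff -> : U' = U by [].
  apply: eq_subv_dim; last by rewrite (dim_generator genM) dU.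
  by rewrite eqU subv_add !(Ccode_sub genM).
apply: span_Yset_sub => y yY; rewrite -(Ccode_capS genM) -eqS.
by have := memL y yY; rewrite inE => /and3P[].
Qed.

Lemma lines_over_dim_gt2 : (2 < \dim <<enum Y>>)%N -> lines_over = set0.
Proof.
move=> dY; have [y1 [y2 [y1Y y2Y _ C12]]] := Yset_independent_pair (ltnW dY).
apply/eqP; apply: contraTT dY => /set0Pn[L /(lines_over_pair y1Y y2Y C12)[_ /dimvS leY]].
rewrite -leqNgt (leq_trans leY) // (leq_trans (dimv_add_leqif _ _)) //.
by rewrite !dim_vline (Yset_neq0 y1Y) (Yset_neq0 y2Y).
Qed.

Lemma lines_over_dim2 : \dim <<enum Y>> = 2 ->
  lines_over = [set subspace_interval k (\bigcap_(y in Y) Ccode M y)%VS U].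
Proof.
move=> dY; have [|y1 [y2 [y1Y y2Y y12 C12]]] := Yset_independent_pair; first by rewrite dY.
have eqY : (<[y1]> + <[y2]> = <<enum Y>>)%VS.
  apply: eq_subv_dim; first by rewrite subv_add -!memvE !Yset_span.
  by rewrite dim_add_line // dim_vline dY (Yset_neq0 y1Y).
have capC y : y \in Y -> (Ccode M y1 :&: Ccode M y2 <= Ccode M y)%VS.
  by move=> yY; rewrite (Ccode_capS genM) eqY Yset_span.
(* As [y1] and [y2] span all of [Y], their two hyperplanes already cut out the whole
   intersection. *)
have -> : (\bigcap_(y in Y) Ccode M y = Ccode M y1 :&: Ccode M y2)%VS.
  apply/eqP; rewrite eqEsubv subv_cap (bigcapv_inf y1) ?(bigcapv_inf y2) ?subvv //=.
  exact/subv_bigcapP.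
apply/eqP; rewrite eqEsubset; apply/andP; split; apply/subsetP => L; rewrite in_set1.
  by case/(lines_over_pair y1Y y2Y C12) => -> _.
have [d1 d2] := (dim_CcodeY y1Y, dim_CcodeY y2Y).
have CU y := Ccode_sub genM y.
have eqU : (Ccode M y1 + Ccode M y2 = U)%VS.
  apply: eq_subv_dim; first by rewrite subv_add !CU.
  by rewrite (dim_generator genM) (dim_add_distinct d1 d2).
move=> /eqP ->; rewrite inE; apply/andP; split.
  apply/linesP; exists (Ccode M y1 :&: Ccode M y2)%VS, U; split=> //.
  - exact: subv_trans (capvSl _ _) (CU y1).
  - have := dimv_sum_cap (Ccode M y1) (Ccode M y2).
    rewrite eqU d1 d2 (dim_generator genM); lia.
  - exact: dim_generator genM.
by rewrite PE; apply/subsetP => _ /imsetP[y yY ->]; rewrite inE capC // CU dim_CcodeY ?eqxx.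
Qed.

End ProjectiveSubcodes.

(** * The four cases told apart by counting *)

Theorem theorem1 (F : finFieldType) (n k : nat)
    (hk1 : (1 < k)%N) (hkn : (k < n - 1)%N)
    (U : {vspace 'rV[F]_n}) (hU : projective_code k.+1 U)
    (M : 'M[F]_(k.+1, n)) (hM : generator_matrix M U) :
  let q := #|F| in
  let Y := Yset M in
  let P := projective_subcodes k U in
  let dimY : nat := \dim <<enum Y>>%VS in
  [/\ (exists2 L, L \in lines F n k & P \subset L) <-> (dimY <= 2)%N,
      (forall L, L \in lines F n k -> P \subset L) <-> dimY = 0%N,
      #|[set L in lines F n k | P \subset L]| = (qnum q k * qnum q (n - k))%N
        <-> dimY = 1%N
    & (#|[set L in lines F n k | P \subset L]| = 1%N <-> dimY = 2%N) /\
      (dimY = 2%N ->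
        [set L in lines F n k | P \subset L] =
        [set subspace_interval k (\bigcap_(y in Y) Ccode M y)%VS U])].
Proof.
move=> q Y P dimY; rewrite -/(lines_over k U).
have [k0 kn] : (0 < k)%N /\ (k < n)%N by lia.
have card_thru (K : {vspace 'rV[F]_n}) (dK : \dim K = k) :=
  card_lines_through k0 dK (ltnW kn).
have avoid (K : {vspace 'rV[F]_n}) : \dim K = k ->
    exists2 L, L \in lines F n k & K \notin L.
  by apply: exists_line_avoiding; rewrite ?hk1.
set N := (qnum q k * qnum q (n - k))%N.
(* Both factors exceed 1, since 1 < k and 1 < n - k. *)
have N_gt1 : (1 < N)%N.
  have q1 := card_finNzRing_gt1 F.
  by rewrite (@ltn_mul 1 1) ?qnum_gt1 //; lia.
(* The lines through a point form a proper subset, because some line avoids that point. *)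
have lines_gtN : (N < #|lines F n k|)%N.
  have [|K _ dK] := @exists_subspace _ _ {:'rV[F]_n} k; first by rewrite dim_rV ltnW.
  rewrite /N -(card_thru K dK); apply: proper_card; apply/properP; split.
    by apply/subsetP => L; rewrite inE => /andP[].
  by have [L LP KL] := avoid K dK; exists L; rewrite // inE LP.
have ex_iff : (exists2 L, L \in lines F n k & P \subset L) <-> (0 < #|lines_over k U|)%N.
  rewrite card_gt0; split=> [[L Ll PL]|/set0Pn[L]].
    by apply/set0Pn; exists L; rewrite inE Ll.
  by rewrite inE => /andP[]; exists L.
have all_iff : (forall L, L \in lines F n k -> P \subset L) <->
    #|lines_over k U| = #|lines F n k|.
  have sub : lines_over k U \subset lines F n k.
    by apply/subsetP => L; rewrite inE => /andP[].
  split=> [all_L | /eqP].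
    by apply: eq_card => L; rewrite inE andb_idr //; apply: all_L.
  rewrite (subset_leqif_card sub).2 => /subsetP le L /le.
  by rewrite inE => /andP[].
have d0 := @lines_over_dim0 F n k U M hU hM.
have d1 := lines_over_dim1 hU hM.
have d2 := lines_over_dim2 hk1 hU hM.
have d3 := lines_over_dim_gt2 hk1 hU hM.
(* The default value 0 of [nth] is the count for every dimension above 2. *)
have card_over : #|lines_over k U| =
    nth 0%N [:: #|lines F n k|; N; 1%N] dimY.
  rewrite -/Y -/dimY in d0 d1 d2 d3.
  case: dimY d0 d1 d2 d3 => [|[|[|d]]] d0 d1 d2 d3.
  - by rewrite d0.
  - by have [//|K dK ->] := d1; rewrite card_thru.
  - by rewrite d2 ?cards1.
  - by rewrite d3 ?cards0 //= nth_nil.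
(* Since T > N' > 1 > 0, the four possible counts are distinct, so the count determines the case. *)
have num_iffs (T N' d : nat) (c := nth 0%N [:: T; N'; 1%N] d) : (1 < N')%N -> (N' < T)%N ->
    [/\ (0 < c)%N <-> (d <= 2)%N, c = T <-> d = 0%N, c = N' <-> d = 1%N & c = 1%N <-> d = 2].
  by rewrite /c; case: d c => [|[|[|d]]] _ /= *; rewrite ?nth_nil; split; lia.
have [iff2 iff0 iff1 iff1'] := num_iffs _ _ dimY N_gt1 lines_gtN.
rewrite -card_over in iff2 iff0 iff1 iff1'.
split; [exact: iff_trans ex_iff iff2 | exact: iff_trans all_iff iff0 | by [] |].
by split; last exact: d2.
Qed.
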